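(* For every $k\ge1$ there is a constant $C_k$ such that for every element $w$ of length $n\ge2$ at the $k$-th level in the lower central series of the free group $F_2$ there is a normal subgroup $H(w)$ of $F_2$ of index at most $C_k(\log n)^{k(k+1)/2}$ which does not contain $w$. Moreover, the subgroup $H(w)$ is the kernel of a homomorphism of $F_2$ onto a $k$-step nilpotent group represented by $(k+1)\times(k+1)$ unipotent matrices.
   Context: The lower central series is $\gamma_1=F_2$, $\gamma_{j+1}=[F_2,\gamma_j]$; an element $w$ is at the $k$-th level if $w\in\gamma_k\setminus\gamma_{k+1}$ (so level $1$ means not in the commutator subgroup). Length is word length in the free generators. *)

(* Defs.v *)
From HB Require Import structures.
From mathcomp Require Import all_boot all_order all_algebra.
From mathcomp Require Import all_fingroup all_solvable.
From mathcomp Require Import boolp classical_sets functions cardinality.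
From mathcomp Require Import reals exp.

Set Implicit Arguments.
Unset Strict Implicit.
Unset Printing Implicit Defensive.

Local Open Scope group_scope.
Local Open Scope classical_set_scope.

(* A letter (i, e) stands for the free generator x_i if e = false and for its
   inverse if e = true, the two generators being indexed by bool. *)
Definition letter : Type := (bool * bool)%type.

Definition linv (l : letter) : letter := (l.1, ~~ l.2).

Definition reduced (s : seq letter) : bool :=
  sorted (fun l m => m != linv l) s.

Definition redcons (l : letter) (s : seq letter) : seq letter :=
  if s is m :: s' then if m == linv l then s' else l :: s else [:: l].

(* The reduced form of u ++ v, when v is already reduced. *)
Definition redcat (u v : seq letter) : seq letter := foldr redcons v u.

Definition winv (s : seq letter) : seq letter := rev (map linv s).

Lemma linvK : involutive linv.
Proof. by case=> i e; rewrite /linv negbK. Qed.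

Lemma reduced_behead l s : reduced (l :: s) -> reduced s.
Proof. by rewrite /reduced; case: s => //= m s /andP[]. Qed.

Lemma redcons_reduced l s : reduced s -> reduced (redcons l s).
Proof.
case: s => // m s rs; rewrite /redcons.
by case: eqVneq => [_|nm]; [exact: reduced_behead rs | rewrite /reduced /= nm].
Qed.

Lemma redcons_id l s : reduced (l :: s) -> redcons l s = l :: s.
Proof. by case: s => //= m s /andP[/negPf->]. Qed.

Lemma redconsK l s : reduced s -> redcons l (redcons (linv l) s) = s.
Proof.
case: s => [|m s] rs; first by rewrite /= eqxx.
rewrite [redcons (linv l) _]/= linvK.
case: eqVneq => [ml|_]; last by rewrite /= eqxx.
by rewrite -ml redcons_id.
Qed.

Lemma redcat_reduced u v : reduced v -> reduced (redcat u v).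
Proof. by move=> rv; elim: u => //= l u; exact: redcons_reduced. Qed.

Lemma redcat_redcons l s v :
  reduced v -> redcat (redcons l s) v = redcons l (redcat s v).
Proof.
move=> rv; case: s => //= m s; case: eqVneq => [->|//].
by rewrite redconsK // redcat_reduced.
Qed.

Lemma redcatA u v w : reduced w ->
  redcat u (redcat v w) = redcat (redcat u v) w.
Proof. by move=> rw; elim: u => //= l u ->; rewrite redcat_redcons. Qed.

Lemma redcats0 u : reduced u -> redcat u [::] = u.
Proof.
elim: u => //= l u IH ru; rewrite IH ?redcons_id //.
exact: reduced_behead ru.
Qed.

Lemma winvK : involutive winv.
Proof. by move=> u; rewrite /winv map_rev revK (mapK linvK). Qed.

Lemma winv_reduced u : reduced u -> reduced (winv u).
Proof.
rewrite /reduced /winv rev_sorted sorted_map; apply: sub_sorted => l m /=.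
by apply: contraNneq => ->; rewrite linvK.
Qed.

Lemma redcatV u v : reduced v -> redcat (winv u) (redcat u v) = v.
Proof.
move=> rv; elim: u => //= l u IH.
rewrite /winv /= rev_cons -cats1 /redcat foldr_cat /= -/(redcat _ _).
rewrite -[X in redcons (linv l) (redcons X _)]linvK redconsK.
  exact: IH.
exact: redcat_reduced.
Qed.

(* The free group of rank 2, realised as the set of reduced words. *)
Record Free2 : Type := MkFree2 { word :> seq letter; _ : reduced word }.

HB.instance Definition _ := [isSub for word].
HB.instance Definition _ := [Choice of Free2 by <:].

Lemma word_reduced (u : Free2) : reduced u. Proof. exact: (valP u). Qed.

Definition Free2_one : Free2 := @MkFree2 [::] isT.
Definition Free2_mul (u v : Free2) : Free2 := MkFree2 (redcat_reduced u (word_reduced v)).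
Definition Free2_inv (u : Free2) : Free2 := MkFree2 (winv_reduced (word_reduced u)).

Lemma Free2_mulA : associative Free2_mul.
Proof. by move=> u v w; apply/val_inj/redcatA/word_reduced. Qed.

Lemma Free2_mul1 : left_id Free2_one Free2_mul.
Proof. by move=> u; exact/val_inj. Qed.

Lemma Free2_mulr1 : right_id Free2_one Free2_mul.
Proof. by move=> u; apply/val_inj/redcats0/word_reduced. Qed.

Lemma Free2_mulV : left_inverse Free2_one Free2_inv Free2_mul.
Proof.
move=> u; apply: val_inj => /=.
by rewrite -{2}[word u]redcats0 ?word_reduced // redcatV.
Qed.

Lemma Free2_mulrV : right_inverse Free2_one Free2_inv Free2_mul.
Proof.
move=> u; rewrite -[X in Free2_mul X](_ : Free2_inv (Free2_inv u) = u) ?Free2_mulV //.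
exact/val_inj/winvK.
Qed.

HB.instance Definition _ :=
  isGroup.Build Free2 Free2_mulA Free2_mul1 Free2_mulr1 Free2_mulV Free2_mulrV.

Definition Free2_gen (i : bool) : Free2 := @MkFree2 [:: (i, false)] isT.

Definition wlength (w : Free2) : nat := size (word w).

Section Eval.
Variables (G : groupType) (g : bool -> G).

Definition leval (l : letter) : G := if l.2 then (g l.1)^-1 else g l.1.

Definition weval (s : seq letter) : G := \prod_(l <- s) leval l.

Lemma leval_inv l : leval (linv l) = (leval l)^-1.
Proof. by case: l => i [] //=; rewrite /leval /= invgK. Qed.

Lemma weval_redcons l s : weval (redcons l s) = leval l * weval s.
Proof.
rewrite /weval; case: s => [|m s]; first by rewrite /= big_seq1 big_nil mulg1.
rewrite [redcons _ _]/=; case: eqVneq => [->|_]; last by rewrite big_cons.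
by rewrite big_cons leval_inv mulgA mulgV mul1g.
Qed.

Lemma weval_redcat u v : weval (redcat u v) = weval u * weval v.
Proof.
elim: u => [|l u IH]; first by rewrite /weval big_nil mul1g.
by rewrite /= weval_redcons IH mulgA; congr mul; rewrite /weval big_cons.
Qed.

Definition Free2_lift (u : Free2) : G := weval u.

Lemma Free2_liftM : {morph Free2_lift : u v / u * v}.
Proof. by move=> u v; exact: weval_redcat. Qed.

HB.instance Definition _ := isMultiplicative.Build Free2 G Free2_lift Free2_liftM.

Lemma Free2_lift_gen i : Free2_lift (Free2_gen i) = g i.
Proof. by rewrite /Free2_lift /weval /= big_seq1. Qed.

End Eval.

Lemma word_weval_gen s : word (weval Free2_gen s) = redcat s [::].
Proof.
elim: s => [|[i e] s IH]; first by rewrite /weval big_nil.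
rewrite /weval big_cons /=.
have -> : leval Free2_gen (i, e) = @MkFree2 [:: (i, e)] isT.
  by rewrite /leval; case: e => //=; exact: val_inj.
by rewrite /= -/(weval Free2_gen s) IH.
Qed.

Lemma weval_genK (u : Free2) : weval Free2_gen u = u.
Proof. by apply: val_inj; rewrite /= word_weval_gen redcats0 ?word_reduced. Qed.

Lemma Free2_lift_unique (G : groupType) (phi : {multiplicative Free2 -> G}) u :
  phi u = Free2_lift (phi \o Free2_gen) u.
Proof.
have phi1 : phi 1 = 1.
  by apply: (mulgI (phi 1)); rewrite -gmulfM !mulg1.
have phiV x : phi x^-1 = (phi x)^-1.
  by apply: (mulgI (phi x)); rewrite -gmulfM !mulgV phi1.
rewrite -{1}(weval_genK u) /Free2_lift /weval (big_morph phi (@gmulfM _ _ phi) phi1).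
by apply: eq_bigr => l _; rewrite /leval; case: l.2; rewrite //= phiV.
Qed.

(* wlength is the word length with respect to the free generators. *)
Lemma wlength_min s (w : Free2) : weval Free2_gen s = w -> wlength w <= size s.
Proof.
move=> <-; rewrite /wlength word_weval_gen; elim: s => //= l s.
case: (redcat s [::]) => //= m t; case: eqP => //= _ /ltnW/leqW.
by move=> h; apply: leq_trans h _.
Qed.

Section Subgroups.
Variable G : groupType.
Implicit Types (A B H : set G).

Definition is_subgroup H : Prop :=
  [/\ H 1, forall x y, H x -> H y -> H (x * y) & forall x, H x -> H x^-1].

Definition is_normal_subgroup H : Prop :=
  is_subgroup H /\ forall x y, H x -> H (x ^ y).

Definition subgroup_generated A : set G := smallest is_subgroup A.

Definition comm_subgroup A B : set G :=
  subgroup_generated [set [~ x, y] | x in A & y in B].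

(* The indexing starts at lcs 1 = G, as in the usual notation gamma_j;
   lcs 0 = G is a junk value. *)
Definition lcs (j : nat) : set G := iter j.-1 (comm_subgroup setT) setT.

Definition at_level (k : nat) (w : G) : Prop := lcs k w /\ ~ lcs k.+1 w.

Definition left_cosets H : set (set G) :=
  [set A | exists x : G, A = [set x * h | h in H]].

Definition has_index H (m : nat) : Prop := (left_cosets H #= `I_m)%card.

End Subgroups.

Definition hom_kernel (G K : groupType) (phi : G -> K) : set G :=
  [set x | phi x = 1].

Definition unipotent_mx (F : fieldType) (n : nat) (A : 'M[F]_n.+1) : Prop :=
  exists m : nat, ((A - 1) ^+ m = 0)%R.

(* Main.v *)
(** The coefficients [magnus x u] of the Magnus expansion [x_i |-> 1 + X_i] of
    [Free2] in non-commuting variables are integers of size at most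
    [(wlength x + 1) ^ size u], and those with [0 < size u < j] vanish on [lcs j].

    Conversely, an element of [lcs k] all of whose coefficients of degree [k] vanish
    is in [lcs k.+1].  By Lazard elimination, carried out on group elements modulo
    [lcs k.+1], every element is a product of powers of iterated commutators that
    play the role of Lyndon words: the lowest-degree part of the Magnus expansion of
    each has coefficient 1 at its smallest word, and these words are pairwise
    distinct.  Hence a product that is not in [lcs k.+1] has a nonzero coefficient
    in degree at most [k].

    So for [w] at level [k] some word [v] of length [k] has [magnus w v != 0].  As
    [|magnus w v|] is polynomial in [wlength w], it is not divisible by some prime
    [p = O(ln (wlength w))].  The matrices whose [(i, j)] entry is the coefficient at
    the subword of [v] between positions [i] and [j], modulo [p], give a homomorphism
    to the unitriangular group of order [p ^ (k * k.+1 / 2)], and the corner entry of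
    the image of [w] is [magnus w v]. *)

Require Import Defs.
From HB Require Import structures.
From mathcomp Require Import all_boot all_order all_algebra.
From mathcomp Require Import all_fingroup all_solvable.
From mathcomp Require Import boolp classical_sets functions cardinality.
From mathcomp Require Import reals exp.
From mathcomp Require Import zify ring.

Set Implicit Arguments.
Unset Strict Implicit.
Unset Printing Implicit Defensive.

Import Order.TTheory GRing.Theory Num.Theory.
Local Open Scope classical_set_scope.

(** * Lower central series *)

Section LowerCentralSeries.
Local Open Scope group_scope.
Variable G : groupType.
Implicit Types (A B H : set G) (x y z : G).

Lemma hall_witt x y z :
  [~ x, y^-1, z] ^ y * [~ y, z^-1, x] ^ z * [~ z, x^-1, y] ^ x = 1.
Proof. by rewrite /commg /conjg !gnorm. Qed.

Lemma subgroup_generatedP A : is_subgroup (subgroup_generated A).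
Proof.
split=> [B [[B1 _ _] _] //|x y Ax Ay B BA|x Ax B BA].
  by case: (BA) => -[_ BM _] _; apply: BM; [apply: Ax|apply: Ay].
by case: (BA) => -[_ _ BV] _; apply: BV; apply: Ax.
Qed.

Lemma subgroup_generated_min A (K : set G) :
  is_subgroup K -> A `<=` K -> subgroup_generated A `<=` K.
Proof. exact: smallest_sub. Qed.

Lemma sub_subgroup_generated A : A `<=` subgroup_generated A.
Proof. exact: sub_gen_smallest. Qed.

Lemma conj_subgroup H z : is_subgroup H -> is_subgroup [set x | H (x ^ z)].
Proof.
case=> H1 HM HV; split=> [|x y Hx Hy|x Hx] /=; rewrite ?conj1g ?conjMg ?conjVg //.
  exact: HM.
exact: HV.
Qed.

Lemma lcsS j : (0 < j)%N -> @lcs G j.+1 = comm_subgroup setT (lcs j).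
Proof. by case: j. Qed.

Lemma lcs_subgroup j : is_subgroup (@lcs G j).
Proof. by case: j => [|[|j]] //; apply: subgroup_generatedP. Qed.

Lemma lcs_one j : @lcs G j 1. Proof. by case: (lcs_subgroup j). Qed.

Lemma lcs_mul j x y : @lcs G j x -> lcs j y -> lcs j (x * y).
Proof. by case: (lcs_subgroup j) => _ h _; apply: h. Qed.

Lemma lcs_inv j x : @lcs G j x -> lcs j x^-1.
Proof. by case: (lcs_subgroup j) => _ _ h; apply: h. Qed.

Lemma lcs_commT j x y : (0 < j)%N -> @lcs G j y -> lcs j.+1 [~ x, y].
Proof.
by move=> j0 jy; rewrite lcsS //; apply: sub_gen_smallest; exists x => //; exists y.
Qed.

Lemma lcs_conj j x z : @lcs G j x -> lcs j (x ^ z).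
Proof.
elim: j x z => [|[|j] IH] // x z.
have /conj_subgroup-/(_ z) s := lcs_subgroup j.+2.
move: x; apply: (smallest_sub s) => _ [a _] [b Hb <-] /=.
by rewrite conjRg; apply: lcs_commT => //; apply: IH.
Qed.

Lemma lcs_normal j : is_normal_subgroup (@lcs G j).
Proof. by split; [apply: lcs_subgroup | move=> *; apply: lcs_conj]. Qed.

Lemma lcs_le i j x : (i <= j)%N -> @lcs G j x -> lcs i x.
Proof.
elim: j => [|j IH] in x *; first by rewrite leqn0 => /eqP->.
rewrite leq_eqVlt => /orP[/eqP-> //|lij].
case: j IH lij => [|j] IH; first by case: (i).
rewrite ltnS => lij jx; apply: IH => //; move: x jx.
apply: (smallest_sub (lcs_subgroup _)) => _ [a _] [b Hb <-].
by rewrite commgEr; apply: lcs_mul => //; apply/lcs_conj/lcs_inv.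
Qed.

(** Three subgroups argument. For a generator [[~ a, b]], the Hall-Witt identity expresses
    [[~ a, b, y]], up to inverses and conjugation, by [[~ b^-1, y^-1, a]] and [[~ y, a^-1, b^-1]],
    both of which the induction on [i] controls. *)
Lemma lcs_comm i j x y :
  (0 < i)%N -> (0 < j)%N -> @lcs G i x -> lcs j y -> lcs (i + j) [~ x, y].
Proof.
case: i => // i _; elim: i j x y => [|i IH] j x y.
  by move=> j0 _ /(lcs_commT x j0).
move=> j0 Hx Hy.
have s : is_subgroup [set z | @lcs G (i.+2 + j) [~ z, y]].
  split=> [|a b Ha Hb|a Ha] /=.
  - by rewrite comm1g; apply: lcs_one.
  - have -> : [~ a * b, y] = [~ a, y] ^ b * [~ b, y].
      by rewrite /commg /conjg !gnorm.
    by apply: lcs_mul => //; apply: lcs_conj.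
  - have -> : [~ a^-1, y] = ([~ a, y] ^ a^-1)^-1.
      by rewrite /commg /conjg !gnorm.
    exact/lcs_inv/lcs_conj.
move: x Hx; apply: (smallest_sub s) => _ [a _] [b Hb <-] /=.
have := hall_witt a b^-1 y; rewrite invgK => HW.
have {}HW : [~ a, b, y] ^ b^-1 = ([~ b^-1, y^-1, a] ^ y * [~ y, a^-1, b^-1] ^ a)^-1.
  by rewrite -[LHS]invgK; congr (_^-1); apply: mulg1_eq; rewrite mulgA.
rewrite -[X in lcs _ X](conjgKV b) HW; apply/lcs_conj/lcs_inv/lcs_mul; apply: lcs_conj.
- rewrite -invgR; apply: lcs_inv; rewrite !addSn; apply: lcs_commT => //.
  by apply: IH => //; apply: lcs_inv.
- rewrite -invgR; apply: lcs_inv; rewrite addSnnS; apply: IH => //; first exact: lcs_inv.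
  by rewrite -invgR; apply/lcs_inv/lcs_commT.
Qed.

End LowerCentralSeries.

(** * Magnus expansion *)

Section Magnus.
Local Open Scope ring_scope.

Definition series := seq bool -> int.

Implicit Types (f g : series) (l : letter) (u v s t : seq bool) (x y : Free2).

(* Left multiplication by [1 + X_i], resp. by its inverse [1 - X_i + X_i^2 - ...],
   where [i = l.1]. *)
Fixpoint letter_act l f u : int :=
  f u + (if u is i :: u' then
           if i == l.1 then (if l.2 then - letter_act l f u' else f u') else 0
         else 0).

Definition series1 : series := fun u => (u == [::])%:R.

Definition magnus_word (w : seq letter) : series := foldr letter_act series1 w.

Definition magnus x : series := magnus_word (word x).

(** Multiplication of power series in non-commuting variables; [convE] gives the usual sum over the
    splittings of [u]. *)
Fixpoint conv f g u : int :=
  f [::] * g u + (if u is i :: u' then conv (fun v => f (i :: v)) g u' else 0).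

Lemma convE f g u :
  conv f g u = \sum_(i < (size u).+1) f (take i u) * g (drop i u).
Proof.
elim: u f => [|i u IH] f; first by rewrite big_ord1 /= addr0.
by rewrite big_ord_recl /= IH; congr (_ + _); apply: eq_bigr => j _.
Qed.

Lemma letter_act_inv l f : letter_act l (letter_act (linv l) f) = f.
Proof.
apply/funext; case: l => j []; elim=> [|i u IH] //=; rewrite ?addr0 //.
  by case: eqP => [_|]; rewrite ?addr0 //= in IH *; rewrite IH addrK.
by case: eqP => [_|]; rewrite ?addr0 //= subrK.
Qed.

Lemma conv_addl f1 f2 g u :
  conv (fun v => f1 v + f2 v) g u = conv f1 g u + conv f2 g u.
Proof. by rewrite !convE -big_split /=; apply: eq_bigr => i _; rewrite mulrDl. Qed.

Lemma conv0l g u : conv (fun=> 0) g u = 0.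
Proof. by rewrite convE big1 // => i _; rewrite mul0r. Qed.

Lemma conv1l g : conv series1 g = g.
Proof.
apply/funext => -[|i u] /=; rewrite mul1r ?addr0 //.
by rewrite -[RHS]addr0; congr (_ + _); apply: conv0l.
Qed.

Lemma letter_act_conv l f g :
  letter_act l (conv f g) = conv (letter_act l f) g.
Proof.
have pos j h : letter_act (j, false) (conv h g) = conv (letter_act (j, false) h) g.
  apply/funext => -[|i u] /=; rewrite ?addr0 // conv_addl -addrA; congr (_ + _).
  by congr (_ + _); case: eqP => // _; rewrite conv0l.
case: l => j []; last exact: pos.
(* The action of [(j, true)] undoes that of [(j, false)], so this case follows from [pos]. *)
rewrite -[in LHS](letter_act_inv (j, false) f) -pos.
by rewrite -[(j, true)]/(linv (j, false)) -{1}[(j, false)]linvK letter_act_inv.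
Qed.

Lemma magnus_word_foldr (w : seq letter) f :
  foldr letter_act f w = conv (magnus_word w) f.
Proof.
by elim: w => [|l w IH] /=; rewrite ?conv1l // IH letter_act_conv.
Qed.

Lemma magnus_redcons l w :
  magnus_word (redcons l w) = letter_act l (magnus_word w).
Proof.
by case: w => //= m w; case: eqP => // ->; rewrite letter_act_inv.
Qed.

Lemma magnusM x y : magnus (x * y)%g = conv (magnus x) (magnus y).
Proof.
rewrite -magnus_word_foldr /magnus /=.
by elim: (word x) => //= l w IH; rewrite magnus_redcons IH.
Qed.

Lemma magnus1 : magnus 1%g = series1. Proof. by []. Qed.

Lemma magnus_nil x : magnus x [::] = 1.
Proof.
rewrite /magnus; elim: (word x) => // l w IH.
by rewrite /= addr0.
Qed.

(** With [s] the size of the tail, (m+1)^(s+1) + (m+2)^s <= (m+1)(m+2)^s + (m+2)^s = (m+2)^(s+1). *)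
Lemma letter_act_bound l f m :
  (forall u, `|f u| <= m.+1%:Z ^+ size u) ->
  forall u, `|letter_act l f u| <= m.+2%:Z ^+ size u.
Proof.
move=> Hf; elim=> [|i u IH] /=; first by rewrite addr0; have := Hf [::].
have le12 : m.+1%:Z ^+ size u <= m.+2%:Z ^+ size u.
  by apply: lerXn2r; rewrite ?nnegrE ?lez_nat.
have Hu : `|if i == l.1 then if l.2 then - letter_act l f u else f u else 0|
    <= m.+2%:Z ^+ size u.
  case: eqP => _; last by rewrite normr0 exprn_ge0.
  by case: l.2 IH => [|_]; rewrite ?normrN //; apply: le_trans le12.
apply: le_trans (ler_normD _ _) _.
rewrite exprS (_ : m.+2%:Z = m.+1%:Z + 1); last by rewrite -addn1 PoszD.
rewrite mulrDl mul1r; apply: lerD; last by rewrite -PoszD addn1.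
apply: le_trans (Hf _) _; rewrite /= exprS -PoszD addn1.
exact: ler_wpM2l.
Qed.

Lemma magnus_bound x u : `|magnus x u| <= (wlength x).+1%:Z ^+ size u.
Proof.
rewrite /magnus /wlength; elim: (word x) u => [|l w IH] u /=.
  by rewrite /series1; case: u => //= *; rewrite expr1n.
exact: letter_act_bound.
Qed.

(** The [j]-th dimension subgroup. The empty word is left out because its coefficient is always
    1. *)
Definition in_deg j x := forall u, (0 < size u < j)%N -> magnus x u = 0.

Lemma magnusM_lowr j x y u :
  (0 < size u <= j)%N -> in_deg j y ->
  magnus (x * y)%g u = magnus x u + magnus y u.
Proof.
move=> /andP[u0 uj] Hy.
rewrite magnusM convE (bigD1 ord0) //= (bigD1 ord_max) /=; last by rewrite -val_eqE /= -lt0n.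
rewrite big1 ?addr0; last first.
  move=> k; rewrite -!val_eqE /= => /andP[k0 km]; have kl := ltn_ord k.
  by rewrite Hy ?mulr0 // size_drop; lia.
by rewrite take0 drop0 take_size drop_size !magnus_nil mul1r mulr1 addrC.
Qed.

Lemma magnusM_lowl j x y u :
  (0 < size u <= j)%N -> in_deg j x ->
  magnus (x * y)%g u = magnus x u + magnus y u.
Proof.
move=> /andP[u0 uj] Hx.
rewrite magnusM convE (bigD1 ord0) //= (bigD1 ord_max) /=; last by rewrite -val_eqE /= -lt0n.
rewrite big1 ?addr0; last first.
  move=> k; rewrite -!val_eqE /= => /andP[k0 km]; have kl := ltn_ord k.
  by rewrite Hx ?mul0r // size_take; case: ifP; lia.
by rewrite take0 drop0 take_size drop_size !magnus_nil mul1r mulr1 addrC.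
Qed.

(** Below degree [j], the expansion of [x^-1 * y] is that of [x^-1 * x = 1]. *)
Lemma magnus_eq_low j x y :
  (forall u, (size u < j)%N -> magnus x u = magnus y u) -> in_deg j (x^-1 * y)%g.
Proof.
move=> e u /andP[u0 uj]; rewrite magnusM convE.
transitivity (conv (magnus x^-1%g) (magnus x) u).
  rewrite convE; apply: eq_bigr => i _; rewrite e // size_drop.
  by apply: leq_ltn_trans uj; apply: leq_subr.
by rewrite -magnusM mulVg magnus1; case: (u) u0.
Qed.

Lemma in_deg_subgroup j : is_subgroup (in_deg j).
Proof.
split=> [u|x y Hx Hy u|x Hx].
- by rewrite magnus1; case: u.
- move=> uj; rewrite (magnusM_lowr (j := j)) ?Hx ?Hy ?addr0 //.
  by case/andP: uj => -> /ltnW.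
- rewrite -[x^-1%g]mulg1; apply: magnus_eq_low => u uj; rewrite magnus1.
  by case: u uj => [|i u] uj; [rewrite magnus_nil | rewrite Hx].
Qed.

(** Write [[~ x, y]] as [(y * x)^-1 * (x * y)]. If [y] is 1 below degree [j], then [x * y] and
    [y * x] agree up to degree [j], where both expansions are additive. *)
Lemma lcs_in_deg j x : lcs j x -> in_deg j x.
Proof.
elim: j x => [|[|j] IH] x; first by move=> _ u; rewrite ltn0 andbF.
  by move=> _ [|i u].
move: x; apply: (smallest_sub (in_deg_subgroup _)) => _ [x _] [y /IH Hy <-].
rewrite (_ : [~ x, y]%g = ((y * x)^-1 * (x * y))%g); last first.
  by rewrite /commg /conjg invgM !mulgA.
apply: magnus_eq_low => u; rewrite ltnS => uj.
case: u uj => [|i u] uj; first by rewrite !magnus_nil.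
by rewrite (magnusM_lowl (j := j.+1)) // (magnusM_lowr (j := j.+1)) // addrC.
Qed.

Lemma magnusX j x n u : (0 < size u <= j)%N -> in_deg j x ->
  magnus (x ^+ n)%g u = magnus x u *+ n.
Proof.
move=> uj Hx; elim: n => [|n IH]; first by rewrite magnus1; case: u uj.
by rewrite expgS (magnusM_lowl _ uj Hx) IH mulrS.
Qed.

Lemma magnusV j x u : (0 < size u <= j)%N -> in_deg j x ->
  magnus (x^-1)%g u = - magnus x u.
Proof.
move=> uj Hx; apply/eqP; rewrite -addr_eq0 -(magnusM_lowr _ uj Hx) mulVg magnus1.
by case: u uj.
Qed.

Lemma magnusM_top i j x y u : (0 < i)%N -> (0 < j)%N ->
    in_deg i x -> in_deg j y -> size u = (i + j)%N ->
  magnus (x * y)%g u =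
    magnus x u + magnus y u + magnus x (take i u) * magnus y (drop i u).
Proof.
move=> i0 j0 Hx Hy su; rewrite magnusM convE.
have u0 : (0 < size u)%N by rewrite su addn_gt0 i0.
have lti : (i < (size u).+1)%N by rewrite su ltnS leq_addr.
rewrite (bigD1 ord0) //= (bigD1 ord_max) /=; last by rewrite -val_eqE /= -lt0n.
rewrite (bigD1 (Ordinal lti)) /=; last first.
  by rewrite -!val_eqE /= -lt0n i0 su /=; lia.
rewrite big1 ?addr0; last first.
  move=> k; rewrite -!val_eqE /= => /andP[/andP[k0 km] ki].
  have kl := ltn_ord k; have [lki|gki] := ltnP k i.
    by rewrite Hx ?mul0r // size_take; case: ifP; lia.
  by rewrite Hy ?mulr0 // size_drop; lia.
rewrite take0 drop0 take_size drop_size !magnus_nil mul1r mulr1.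
by rewrite addrA [magnus y u + _]addrC.
Qed.

(** The lowest part of a commutator is the Lie bracket of the lowest parts; this comes from
    comparing both sides of [x * y = y * x * [~ x, y]] in degree [i + j]. *)
Lemma magnus_comm i j x y u : (0 < i)%N -> (0 < j)%N ->
    lcs i x -> lcs j y -> size u = (i + j)%N ->
  magnus [~ x, y]%g u = magnus x (take i u) * magnus y (drop i u)
                      - magnus y (take j u) * magnus x (drop j u).
Proof.
move=> i0 j0 Hx Hy su.
have uij : (0 < size u <= i + j)%N by rewrite su leqnn addn_gt0 i0.
have Hc : in_deg (i + j) [~ x, y]%g by apply/lcs_in_deg/lcs_comm.
have := magnusM_lowr (y * x)%g uij Hc; rewrite -commgC.
move/lcs_in_deg in Hx; move/lcs_in_deg in Hy.
rewrite (magnusM_top i0 j0 Hx Hy su) (magnusM_top j0 i0 Hy Hx) 1?addnC //.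
move=> e.
apply: (addrI (magnus y u + magnus x u + magnus y (take j u) * magnus x (drop j u))).
by rewrite -e; ring.
Qed.

End Magnus.

(** * Leading words *)

Section WordOrder.
Implicit Types (s t u v : seq bool).

(* Words that are prefixes of each other are incomparable, which makes [slt] stable
   under concatenation on the right (see [slt_cat]). *)
Fixpoint slt s t : bool :=
  match s, t with
  | x :: s', y :: t' => (~~ x && y) || (x == y) && slt s' t'
  | _, _ => false
  end.

Lemma slt_irr s : slt s s = false.
Proof. by elim: s => //= x s ->; rewrite andNb andbF. Qed.

Lemma slt_trans t s u : slt s t -> slt t u -> slt s u.
Proof.
elim: s t u => [|x s IH] [|y t] [|z u] //=.
case: x; case: y; case: z => //=; rewrite ?orbF //; exact: IH.
Qed.

Lemma slt_total s t : size s = size t -> [\/ slt s t, s = t | slt t s].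
Proof.
elim: s t => [|x s IH] [|y t] //=; first by constructor 2.
by case=> /IH[st|->|ts]; case: x; case: y => /=;
  rewrite ?orbF ?slt_irr; (try by constructor 1); (try by constructor 2);
  constructor 3.
Qed.

Lemma slt_cat s t u v : slt s t -> slt (s ++ u) (t ++ v).
Proof.
elim: s t => [|x s IH] [|y t] //= /orP[->//|/andP[-> /IH->]].
by rewrite orbT.
Qed.

Lemma slt_catl p s t : slt (p ++ s) (p ++ t) = slt s t.
Proof. by elim: p => //= x p ->; rewrite andNb eqxx. Qed.

(* Base-3 expansion padded with zeros, so that a prefix comes before its extensions. *)
Fixpoint enc k s : nat :=
  match k, s with
  | k'.+1, x :: s' => x.+1 * 3 ^ k' + enc k' s'
  | _, _ => 0
  end.

Lemma enc_ub k s : enc k s < 3 ^ k.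
Proof.
elim: k s => // k IH [|x s] /=; first by rewrite expn_gt0.
by rewrite expnS; have := IH s; case: x => /=; lia.
Qed.

Lemma slt_enc k s t : size s <= k -> size t <= k -> slt s t -> enc k s < enc k t.
Proof.
elim: k s t => [|k IH] [|x s] [|y t] //=; rewrite !ltnS => sk tk.
case/orP=> [/andP[/negPf-> ->]|/andP[/eqP-> /(IH _ _ sk tk)]] /=.
  by have := enc_ub k s; lia.
by rewrite ltn_add2l.
Qed.

Lemma enc_cat k s t : t != [::] -> size s < k -> enc k s < enc k (s ++ t).
Proof.
move=> t0; elim: k s => [|k IH] [|x s] //= sk; last by rewrite ltn_add2l IH.
case: t t0 {IH} => //= y t _.
by have : 0 < 3 ^ k by [rewrite expn_gt0]; case: y; lia.
Qed.

End WordOrder.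

Section Leading.
Local Open Scope ring_scope.
Implicit Types (s t u v : seq bool) (x y a b : Free2).

(** The degree-lexicographic order, which differs from the purely lexicographic order given by [enc]
    when lengths differ. *)
Definition lower u v := (size u < size v)%N || (size u == size v) && slt u v.

Lemma lower_trans v u w : lower u v -> lower v w -> lower u w.
Proof.
rewrite /lower => /orP[uv|/andP[/eqP uv suv]] /orP[vw|/andP[/eqP vw svw]].
- by rewrite (ltn_trans uv vw).
- by rewrite -vw uv.
- by rewrite uv vw.
- by rewrite uv vw eqxx (slt_trans suv svw) orbT.
Qed.

Definition leading x v := [/\ (0 < size v)%N, magnus x v != 0 &
  forall u, (0 < size u)%N -> lower u v -> magnus x u = 0].

(** Stands for a Lyndon word [s] with its iterated commutator [a]. The coefficient 1 at [s] survives
    commutation and makes every nontrivial power of [a] visible at [s]. *)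
Definition item s a := [/\ (0 < size s)%N, lcs (size s) a, magnus a s = 1 &
  forall u, size u = size s -> slt u s -> magnus a u = 0].

Lemma leading_in_deg x v : leading x v -> in_deg (size v) x.
Proof. by case=> _ _ Hv u /andP[u0 uv]; rewrite Hv // /lower uv. Qed.

Lemma item_lower s a u : item s a -> (0 < size u)%N -> lower u s -> magnus a u = 0.
Proof.
case=> s0 Hs a1 al u0 /orP[us|/andP[/eqP us /al]]; last exact.
by apply: (lcs_in_deg Hs); rewrite u0.
Qed.

Lemma item_geq s a u : item s a -> size u = size s -> magnus a u != 0 -> u = s \/ slt s u.
Proof.
case=> _ _ _ al us; case: (slt_total us) => [/(al _ us)->|->|su] // _.
  by left.
by right.
Qed.

(* [P_a P_b - P_b P_a] has lowest word [s ++ t], the words of [P_b P_a] being at least [t ++ s]. *)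
Lemma item_comm s a t b :
  item s a -> item t b -> slt (s ++ t) (t ++ s) -> item (s ++ t) [~ a, b]%g.
Proof.
move=> Ia Ib st; have [s0 Hs a1 al] := Ia; have [t0 Ht b1 bl] := Ib.
have second u : size u = size (s ++ t) -> u = s ++ t \/ slt u (s ++ t) ->
    magnus b (take (size t) u) * magnus a (drop (size t) u) = 0.
  move=> su ust; apply/eqP; rewrite mulf_eq0; apply/norP => -[nb na].
  have {}su : size u = (size t + size s)%N by rewrite su size_cat addnC.
  have sv1 : size (take (size t) u) = size t by rewrite size_takel // su leq_addr.
  have sv2 : size (drop (size t) u) = size s by rewrite size_drop su addKn.
  have ge : u = t ++ s \/ slt (t ++ s) u.
    rewrite -[u](cat_take_drop (size t)).
    have [->|tv] := item_geq Ib sv1 nb; last by right; apply: slt_cat.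
    have [->|sv] := item_geq Ia sv2 na; first by left.
    by right; rewrite slt_catl.
  case: ust ge => [->|ust] [e|e].
  - by rewrite -e slt_irr in st.
  - by have := slt_trans e st; rewrite slt_irr.
  - by have := slt_trans st (eq_ind _ (slt^~ _) ust _ e); rewrite slt_irr.
  - by have := slt_trans (slt_trans st e) ust; rewrite slt_irr.
split.
- by rewrite size_cat addn_gt0 s0.
- by rewrite size_cat; apply: lcs_comm.
- rewrite (magnus_comm s0 t0 Hs Ht) ?size_cat // second; [|by []|by left].
  by rewrite take_size_cat // drop_size_cat // a1 b1 mul1r subr0.
- move=> u su us; rewrite (magnus_comm s0 t0 Hs Ht) -?size_cat //.
  rewrite second //; last by right.
  rewrite subr0; apply/eqP; rewrite mulf_eq0; apply/norP => -[na nb].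
  have sv1 : size (take (size s) u) = size s by rewrite size_takel // su size_cat leq_addr.
  have sv2 : size (drop (size s) u) = size t by rewrite size_drop su size_cat addKn.
  have := us; rewrite -[u](cat_take_drop (size s)).
  have [->|sv] := item_geq Ia sv1 na.
    rewrite slt_catl; have [->|tv] := item_geq Ib sv2 nb; first by rewrite slt_irr.
    by move=> /(slt_trans tv); rewrite slt_irr.
  by move=> /(slt_trans (slt_cat t (drop (size s) u) sv)); rewrite slt_irr.
Qed.

(** The comparison that [item_comm] requires at each iteration; the common prefix [s] cancels. *)
Lemma slt_iter_cat n s t : slt s t ->
  slt (s ++ iter n (cat s) t) (iter n (cat s) t ++ s).
Proof.
by move=> st; elim: n => [|n IH] /=; [apply: slt_cat | rewrite -catA slt_catl].
Qed.

Lemma item_iter n s a t b : item s a -> item t b -> slt s t ->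
  item (iter n (cat s) t) (iter n (commg a) b).
Proof.
move=> Ia Ib st; elim: n => //= n IH.
by apply: item_comm => //; apply: slt_iter_cat.
Qed.

Lemma size_iter_cat n s t : size (iter n (cat s) t) = (n * size s + size t)%N.
Proof. by elim: n => //= n IH; rewrite size_cat IH mulSn addnA. Qed.

End Leading.

(** * Elimination *)

Section CycleProduct.
Local Open Scope group_scope.
Variable G : groupType.
Implicit Types (A B K : set G) (x y z : G).

Lemma subgroup_exp K x n : is_subgroup K -> K x -> K (x ^+ n).
Proof. by case=> K1 KM _ Kx; elim: n => // n IH; rewrite expgS; apply: KM. Qed.

(** The product of the cyclic group of [a] with a subgroup that [a] normalises. An integer power of
    [a] is written with two natural exponents. *)
Lemma cycle_mul_subgroup a K : is_subgroup K ->
    (forall y, K y -> K (y ^ a)) -> (forall y, K y -> K (y ^ a^-1)) ->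
  is_subgroup [set x | exists m n, exists2 y, K y & x = a ^+ m * a ^- n * y].
Proof.
move=> sK Ka KaV; have [K1 KM KV] := sK.
have KX m y : K y -> K (y ^ a ^+ m).
  by elim: m y => [|m IH] y Ky; rewrite ?conjg1 // expgS conjgM; apply/IH/Ka.
have KXV m y : K y -> K (y ^ a ^- m).
  rewrite -expVgn.
  by elim: m y => [|m IH] y Ky; rewrite ?conjg1 // expgS conjgM; apply/IH/KaV.
have cX m n : commute (a ^- n) (a ^+ m).
  by apply/commute_sym/commuteV/commuteX2.
split=> [|_ _ [m [n [y Ky ->]]] [m' [n' [y' Ky' ->]]]|_ [m [n [y Ky ->]]]].
- by exists 0, 0, 1; rewrite // !expg0 invg1 !mulg1.
- exists (m + m')%N, (n + n')%N, (y ^ (a ^+ m' * a ^- n') * y').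
    by apply: KM => //; rewrite conjgM; apply/KXV/KX.
  rewrite expgnDr (addnC n) expgnDr invgM -!mulgA; congr (_ * _).
  rewrite [RHS]mulgA -cX -mulgA; congr (_ * _).
  by rewrite !mulgA mulgV mul1g.
- exists n, m, (y^-1 ^ (a ^+ n * a ^- m)).
    by rewrite conjgM; apply/KXV/KX/KV.
  by rewrite -conjgC !invgM invgK.
Qed.

End CycleProduct.

Section Normalised.
Local Open Scope group_scope.
Variable G : groupType.
Implicit Types (A T N : set G) (x y z : G).

Definition iter_comms a T : set G :=
  [set c | exists2 t, T t & exists n, c = iter n (commg a) t].

(* With [c_n = [a, ..., [a, t]]], one has [c_n ^ a = c_n / c_(n+1)], hence
   [c_n ^ a^-1 = c_n * c_(n+1) ^ a^-1]; the latter is resolved by descending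
   induction, starting from large [n] for which [c_n] is in [N]. *)
Lemma iter_comms_normalised a T N :
    is_normal_subgroup N ->
    (forall t, T t -> exists m, forall n, m <= n -> N (iter n (commg a) t)) ->
  let K := subgroup_generated (iter_comms a T `|` N) in
  forall y, K y -> K (y ^ a) /\ K (y ^ a^-1).
Proof.
move=> [sN nN] TN K; have sK : is_subgroup K by apply: subgroup_generatedP.
have [K1 KM KV] := sK.
have KN x : N x -> K x by move=> Nx; apply: sub_subgroup_generated; right.
have Kc t n : T t -> K (iter n (commg a) t).
  by move=> Tt; apply: sub_subgroup_generated; left; exists t => //; exists n.
have conjS c : c ^ a = c * [~ a, c]^-1.
  by rewrite invgR commgEl mulVKg.
move=> y Ky; split; move: y Ky.
  apply: subgroup_generated_min (conj_subgroup a sK) _ => y [[t Tt [n ->]]|Ny] /=.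
    by rewrite conjS; apply: KM; [exact: Kc | apply: KV; exact: (Kc _ n.+1)].
  by apply: KN; apply: nN.
apply: subgroup_generated_min (conj_subgroup a^-1 sK) _ => y [[t Tt [n ->]]|Ny] /=.
  have [m Hm] := TN t Tt.
  have [d] := ubnP (m - n); elim: d n => // d IH n lt.
  have [/Hm Nn|ltnm] := leqP m n; first by apply: KN; apply: nN.
  have -> : iter n (commg a) t ^ a^-1 =
      iter n (commg a) t * iter n.+1 (commg a) t ^ a^-1.
    by rewrite /= -[X in _ = X * _](conjgK a) conjS -conjMg mulgVK.
  by apply: KM; [exact: Kc | apply: IH; rewrite subnS; lia].
by apply: KN; apply: nN.
Qed.

End Normalised.

Section MagnusElimination.
Local Open Scope ring_scope.
Implicit Types (s t u v : seq bool) (x y a b : Free2).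

(* Lazard elimination: an element [(s, a)] with [s] smallest in [S] is removed at the
   cost of replacing the other elements [t] by the iterated commutators
   [[a, ..., [a, t]]], whose words [s ... s t] are larger than [s]. *)
Lemma elimination k M (S : set (seq bool * Free2)) :
    (forall p, S p -> item p.1 p.2 /\ (size p.1 <= k)%N) ->
    (forall p q, S p -> S q -> [\/ p = q, slt p.1 q.1 | slt q.1 p.1]) ->
    (forall p, S p -> (3 ^ k <= enc k p.1 + M)%N) ->
  forall x, subgroup_generated (snd @` S `|` lcs k.+1) x ->
    lcs k.+1 x \/
    exists v, [/\ leading x v, (size v <= k)%N & exists2 p, S p & (enc k p.1 <= enc k v)%N].
Proof.
elim: M S => [|M IH] S S1 S2 S3 x.
  (* When [M] is 0, the strict bound [enc_ub] forces [S] to be empty. *)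
  move=> Hx; left; move: x Hx; apply: subgroup_generated_min; first exact: lcs_subgroup.
  by move=> y [[p /S3 + _]|//]; rewrite addn0 leqNgt enc_ub.
have [[p1 Sp1]|S0] := pselect (exists p, S p); last first.
  move=> Hx; left; move: x Hx; apply: subgroup_generated_min; first exact: lcs_subgroup.
  by move=> y [[p Sp _]|//]; case: S0; exists p.
pose P n := `[< exists2 p, S p & enc k p.1 = n >].
have exP : exists n, P n by exists (enc k p1.1); apply/asboolP; exists p1.
(* The word [s] has the least encoding in [S]; eliminating it raises this minimum, so [M] can
   decrease. *)
case: (ex_minnP exP) => n0 /asboolP[[s a] Ssa /= en0] minn0.
have [Ia sk] := S1 _ Ssa; rewrite /= in Ia sk.
have s_lt p : S p -> p <> (s, a) -> slt s p.1.
  move=> Sp ps; case: (S2 _ _ Sp Ssa) => [/ps//|/= lt|//].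
  have /minn0 : P (enc k p.1) by apply/asboolP; exists p.
  by rewrite -en0 leqNgt slt_enc //; case: (S1 _ Sp).
pose T := [set b | exists2 p, S p & p <> (s, a) /\ b = p.2].
pose S' := [set q | exists p n, [/\ S p, p <> (s, a),
  q = (iter n (cat s) p.1, iter n (commg a) p.2) & (size q.1 <= k)%N]].
have ItS p n : S p -> p <> (s, a) ->
    item (iter n (cat s) p.1) (iter n (commg a) p.2).
  by move=> Sp ps; apply: item_iter => //; [case: (S1 _ Sp) | apply: s_lt].
have itN p n : S p -> p <> (s, a) -> (k < size (iter n (cat s) p.1))%N ->
    lcs k.+1 (iter n (commg a) p.2).
  by move=> Sp ps lt; have [_ h _ _] := ItS _ n Sp ps; apply: lcs_le h.
have s0 : (0 < size s)%N by case: Ia.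
have enc_S' q : S' q -> (enc k s < enc k q.1)%N.
  move=> [p [[|n] [Sp ps -> /= sz]]]; first by apply: slt_enc => //; apply: s_lt.
  have [t0 _ _ _] := ItS p n Sp ps.
  apply: enc_cat; first by rewrite -size_eq0 -lt0n.
  by apply: leq_trans sz; rewrite size_cat -{1}[size s]addn0 ltn_add2l.
have {}IH : forall x, subgroup_generated (snd @` S' `|` lcs k.+1) x ->
    lcs k.+1 x \/ exists v, [/\ leading x v, (size v <= k)%N &
      exists2 p, S' p & (enc k p.1 <= enc k v)%N].
  apply: IH => [q [p [n [Sp ps -> sz]]]|q q'|q Sq].
  - by split=> //; apply: ItS.
  - move=> [p [n [Sp ps -> sz]]] [p' [n' [Sp' ps' -> sz']]] /=.
    (* Once [m] copies of [s] are cancelled, the left word starts with [s] and the right one is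
       [r'.1], which is above [s]. So more iterations give a smaller word. *)
    have key m d r r' : S r -> S r' -> r <> (s, a) -> r' <> (s, a) ->
        slt (iter (m + d.+1) (cat s) r.1) (iter m (cat s) r'.1).
      move=> Sr Sr' rs rs'; rewrite iterD; elim: m => /= [|m IHm].
        by rewrite -[r'.1]cats0; apply/slt_cat/s_lt.
      by rewrite slt_catl.
    case: (ltngtP n n') => [lt|lt|<-].
    + by constructor 3; rewrite -(subnKC (ltnW lt)) -[(n' - n)%N]prednK ?subn_gt0 //; apply: key.
    + by constructor 2; rewrite -(subnKC (ltnW lt)) -[(n - n')%N]prednK ?subn_gt0 //; apply: key.
    + have slt_it r r' : slt (iter n (cat s) r) (iter n (cat s) r') = slt r r'.
        by elim: n {sz sz'} => //= n <-; rewrite slt_catl.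
      rewrite !slt_it; case: (S2 _ _ Sp Sp') => [->|lt|lt].
      * by constructor 1.
      * by constructor 2.
      * by constructor 3.
  - by have := enc_S' _ Sq; have := S3 _ Ssa; rewrite /=; lia.
pose K := subgroup_generated (iter_comms a T `|` lcs k.+1).
have sK : is_subgroup K by apply: subgroup_generatedP.
have Kconj : forall y, K y -> K (y ^ a)%g /\ K (y ^ a^-1)%g.
  apply: iter_comms_normalised; first exact: lcs_normal.
  move=> z [p Sp [ps ->]]; exists k.+1 => n ltn.
  apply: itN => //; rewrite size_iter_cat.
  by have := leq_mul ltn s0; rewrite muln1; lia.
have KS' y : K y -> subgroup_generated (snd @` S' `|` lcs k.+1) y.
  move: y; apply: subgroup_generated_min; first exact: subgroup_generatedP.
  move=> z [[_ [p Sp [ps ->]] [n ->]]|Ny]; last by apply: sub_subgroup_generated; right.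
  apply: sub_subgroup_generated.
  have [le|gt] := leqP (size (iter n (cat s) p.1)) k; last by right; apply: itN.
  left; exists (iter n (cat s) p.1, iter n (commg a) p.2) => //.
  by exists p, n.
(* As [a] normalises [K], every element splits as a power of [a] times an element of [K], to which
   the induction hypothesis applies through [KS']. *)
have sub : subgroup_generated (snd @` S `|` lcs k.+1) `<=`
    [set x | exists m n, exists2 y, K y & x = (a ^+ m * a ^- n * y)%g].
  apply: subgroup_generated_min.
    by apply: cycle_mul_subgroup => // y /Kconj[].
  have Kin y : K y -> exists m n, exists2 z, K z & y = (a ^+ m * a ^- n * z)%g.
    by move=> Ky; exists 0%N, 0%N, y; rewrite // expg0 invg1 !mul1g.
  move=> z [[p Sp <-]|Ny]; last by apply: Kin; apply: sub_subgroup_generated; right.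
  have [->|ps] := pselect (p = (s, a)).
    exists 1%N, 0%N, 1%g; first by case: sK.
    by rewrite expg1 expg0 invg1 !mulg1.
  apply: Kin; apply: sub_subgroup_generated; left; exists p.2; last by exists 0%N.
  by exists p.
move=> /sub[m [n [y /KS'/IH Hy ->]]] {sub IH}.
have Da : in_deg (size s) a by case: Ia => _ /lcs_in_deg.
have sD := in_deg_subgroup (size s).
have Dz : in_deg (size s) (a ^+ m * a ^- n)%g.
  have [_ DM DV] := sD.
  by apply: DM; last apply: DV; exact: subgroup_exp _ sD Da.
have [->|mn] := eqVneq m n.
  rewrite mulgV mul1g; case: Hy => [Ny|[v [lv sv [p Sp pv]]]]; first by left.
  right; exists v; split=> //; exists (s, a) => //=.
  by apply: leq_trans pv; apply/ltnW/enc_S'.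
have zE u : (0 < size u <= size s)%N ->
    magnus (a ^+ m * a ^- n)%g u = (m%:Z - n%:Z) * magnus a u.
  move=> us; rewrite (magnusM_lowl _ us); last exact: subgroup_exp _ sD Da.
  rewrite (magnusV us); last exact: subgroup_exp _ sD Da.
  by rewrite !(magnusX _ us Da) mulrBl -!natz !mulr_natl.
have lead_s : (forall u, (0 < size u)%N -> u = s \/ lower u s -> magnus y u = 0) ->
    leading (a ^+ m * a ^- n * y)%g s.
  move=> H; have ls u : lower u s -> (size u <= size s)%N.
    by case/orP=> [/ltnW//|/andP[/eqP-> _]].
  split=> // [|u u0 us].
    rewrite (magnusM_lowl (j := size s)) ?leqnn ?s0 // zE ?leqnn ?s0 // H //; last by left.
    case: Ia => _ _ -> _; rewrite mulr1 addr0 subr_eq0.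
    by apply: contra mn => /eqP[->].
  rewrite (magnusM_lowl (j := size s)) ?u0 ?ls // zE ?u0 ?ls // H //; last by right.
  by rewrite (item_lower Ia u0 us) mulr0 addr0.
have lower_size u v : lower u v -> (size u <= size v)%N.
  by case/orP=> [/ltnW//|/andP[/eqP-> _]].
case: Hy => [Ny|[v [lv sv [p Sp pv]]]].
  right; exists s; split=> //; last by exists (s, a).
  apply: lead_s => u u0 us; apply: (lcs_in_deg Ny).
  by rewrite u0 ltnS; apply: leq_trans sk; case: us => [->//|/lower_size].
have esv : (enc k s < enc k v)%N by apply: leq_trans pv; apply: enc_S'.
right; have [v0 yv yl] := lv.
(* If [s] is below the leading word [v] of [y], the power of [a] decides and [s] leads. Otherwise
   [v] is strictly shorter than [s], since equal lengths would contradict [esv], and [v] leads. *)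
have [lt|gt] := boolP (lower s v).
  exists s; split=> //; last by exists (s, a).
  apply: lead_s => u u0 [us|us]; apply: yl => //; first by rewrite us.
  exact: lower_trans us lt.
have sizevs : (size v < size s)%N.
  move: gt; rewrite /lower negb_or -leqNgt => /andP[].
  rewrite leq_eqVlt => /orP[/eqP e|//]; rewrite e eqxx /=.
  case: (slt_total e) => [lt|e'|-> //].
  - by have := slt_enc sv sk lt; rewrite ltnNge ltnW.
  - by rewrite e' ltnn in esv.
exists v; split=> //; last by exists (s, a) => //; apply: ltnW.
have low u : (0 < size u <= size v)%N ->
    magnus (a ^+ m * a ^- n * y)%g u = magnus y u.
  move=> uv; rewrite (magnusM_lowr _ uv (leading_in_deg lv)).
  by rewrite Dz ?add0r //; case/andP: uv => -> /leq_ltn_trans; apply.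
split=> // [|u u0 uv]; rewrite low ?v0 ?leqnn ?u0 ?lower_size //.
exact: yl.
Qed.

Lemma item_gen i : item [:: i] (Free2_gen i).
Proof.
split=> //; first by rewrite /magnus /= eqxx.
move=> [|j [|? ?]] // _.
by rewrite /magnus /=; case: j; case: i.
Qed.

Lemma free2_generated (K : set Free2) : is_subgroup K ->
  (forall i, K (Free2_gen i)) -> forall x, K x.
Proof.
move=> [K1 KM KV] Kg x; rewrite -(weval_genK x) /weval.
elim: (word x) => [|[i e] w IH]; first by rewrite big_nil.
rewrite big_cons; apply: KM => //; rewrite /leval /=.
by case: e; [apply: KV|].
Qed.

(** Elimination started from the two generators gives a leading word of length at most [k];
    [lcs_in_deg] excludes a shorter one. *)
Lemma magnus_detects k x : (0 < k)%N -> at_level k x ->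
  exists2 v, size v = k & magnus x v != 0.
Proof.
move=> k0 [xk xnk].
pose S := [set p | exists i, p = ([:: i], Free2_gen i)].
have S1 p : S p -> item p.1 p.2 /\ (size p.1 <= k)%N.
  by move=> [i ->]; split=> //; apply: item_gen.
have S2 p q : S p -> S q -> [\/ p = q, slt p.1 q.1 | slt q.1 p.1].
  move=> [i ->] [j ->] /=; case: i; case: j => /=;
    by [constructor 1|constructor 2|constructor 3].
have S3 p : S p -> (3 ^ k <= enc k p.1 + 3 ^ k)%N by rewrite leq_addl.
have Sx : subgroup_generated (snd @` S `|` lcs k.+1) x.
  apply: free2_generated; first exact: subgroup_generatedP.
  move=> i; apply: sub_subgroup_generated; left.
  by exists ([:: i], Free2_gen i) => //; exists i.
have [//|[v [lv vk _]]] := elimination S1 S2 S3 Sx.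
have [v0 xv _] := lv; exists v => //; apply/eqP; rewrite eqn_leq vk leqNgt.
by apply/negP => lt; rewrite (lcs_in_deg xk) ?v0 // eqxx in xv.
Qed.

End MagnusElimination.

(** * Primes not dividing a given integer *)

Section SmallNonDivisor.
Implicit Types (p m n r t c : nat).

(** Legendre's formula with extra zero terms, so that the sums for [m] and [2 * m] have the same
    range. *)
Lemma logn_fact_wide p m n : prime p -> m <= n ->
  logn p m`! = \sum_(1 <= i < n.+1) m %/ p ^ i.
Proof.
move=> pp mn; rewrite logn_fact // [RHS](@big_cat_nat _ _ _ m.+1) //=.
rewrite [X in _ = _ + X]big_nat_cond [X in _ = _ + X]big1 ?addn0 // => i.
rewrite andbT => /andP[mi _]; rewrite divn_small //.
by apply: leq_trans (ltn_expl i (prime_gt1 pp)); apply: ltnW.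
Qed.

(** In Legendre's formula, the floor of 2m/p^i exceeds twice that of m/p^i by at most 1, and
    vanishes for i > t. *)
Lemma logn_central_bin p m t : prime p -> 2 * m < p ^ t.+1 ->
  logn p 'C(2 * m, m) <= t.
Proof.
move=> pp lt; have m2 : m <= 2 * m by lia.
have /(congr1 (logn p)) := bin_fact m2.
rewrite (_ : 2 * m - m = m); last by lia.
rewrite !lognM ?muln_gt0 ?fact_gt0 ?bin_gt0 // => e.
suff: logn p (2 * m)`! <= logn p m`! + logn p m`! + t by lia.
rewrite (logn_fact_wide pp (leqnn (2 * m))) !(logn_fact_wide pp m2).
have le1 n : \sum_(1 <= i < n.+1) (i <= t) <= t.
  elim: n => [|n IH]; first by rewrite big_geq.
  have [tn|nt] := leqP t n; first by rewrite big_nat_recr //= [n < t]ltnNge tn addn0.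
  apply: leq_trans nt; apply: (@leq_trans (\sum_(1 <= i < n.+2) 1)).
    by apply: leq_sum => i _; apply: leq_b1.
  by rewrite sum_nat_const_nat muln1 subn1.
apply: leq_trans (leq_add (leqnn _) (le1 (2 * m))).
rewrite -!big_split /=; apply: leq_sum => i _.
have pi0 : 0 < p ^ i by rewrite expn_gt0 prime_gt0.
have [it|ti] := leqP i t.
  rewrite -ltnS ltn_divLR //.
  by have := ltn_ceil m pi0; set q := m %/ p ^ i; rewrite /=; nia.
by rewrite divn_small //; apply: leq_trans lt _; rewrite leq_exp2l ?prime_gt1.
Qed.

Lemma central_bin_lb m : 2 ^ m <= 'C(2 * m, m).
Proof.
elim: m => [|m IH]; first by rewrite bin0.
rewrite (_ : 2 * m.+1 = (2 * m).+2); last by lia.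
rewrite binS (_ : 'C((2 * m).+1, m.+1) = 'C((2 * m).+1, m)); last first.
  by rewrite -bin_sub; [congr 'C(_, _); lia | lia].
rewrite expnS addnn -mul2n leq_mul2l /=; apply: leq_trans IH _.
by case: m => [|m]; rewrite ?bin0 // binS leq_addr.
Qed.

(* If all primes up to [4 ^ r.+1] divided [c], then ['C(4 ^ r.+1, 4 ^ r.+1 / 2)] would divide
   [(2 ^ r.+1)`! ^ (2 * r.+1) * c], the primes above [2 ^ r.+1] occurring in it at most once. *)
Lemma exists_prime_nondivisor r c : 9 <= r -> 0 < c -> c < 2 ^ 4 ^ r ->
  exists p, [/\ prime p, p <= 4 ^ r.+1 & ~~ (p %| c)].
Proof.
move=> r9 c0 clt; apply: contrapT => none.
have pc p : prime p -> p <= 4 ^ r.+1 -> p %| c.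
  by move=> pp ple; apply: contrapT => /negP pc; apply: none; exists p.
pose m := 2 * 4 ^ r.
have m2 : 2 * m = 4 ^ r.+1 by rewrite mulnA expnS.
have sq : 4 ^ r.+1 = (2 ^ r.+1) ^ 2 by rewrite -expnM mulnC expnM.
have dv : 'C(2 * m, m) %| (2 ^ r.+1)`! ^ (2 * r.+1) * c.
  apply/dvdn_partP => [|p]; first by rewrite bin_gt0; lia.
  rewrite mem_primes => /and3P[pp _ _].
  rewrite p_part pfactor_dvdn ?muln_gt0 ?expn_gt0 ?fact_gt0 //.
  rewrite lognM ?expn_gt0 ?fact_gt0 // lognX.
  have [ple|plt] := leqP p (2 ^ r.+1).
    (* Small primes: p^(2(r+1)+1) exceeds 4^(r+1), so the exponent is at most 2(r+1). The power of
       the factorial absorbs it, as [p] divides the factorial. *)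
    apply: leq_trans (leq_addr _ _); apply: (@leq_trans (2 * r.+1)).
      apply: logn_central_bin => //; rewrite m2 [p ^ _]expnS.
      apply: (@leq_trans (2 * 2 ^ (2 * r.+1))).
        by rewrite sq -expnM mulnC ltn_Pmull ?expn_gt0.
      by rewrite leq_mul ?prime_gt1 // leq_exp2r ?prime_gt1 ?muln_gt0.
    rewrite -{1}[2 * r.+1]muln1 leq_mul2l /= -pfactor_dvdn ?fact_gt0 // expn1.
    by rewrite dvdn_fact // prime_gt0.
  have [ple|plt'] := leqP p (4 ^ r.+1).
    (* Middle primes: p^2 exceeds 4^(r+1), so the exponent is at most 1, and [c] supplies it. *)
    apply: (@leq_trans 1); first by apply: logn_central_bin => //; rewrite m2 sq ltn_exp2r.
    apply: leq_trans (leq_addl _ _).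
    by rewrite -pfactor_dvdn // expn1 pc.
  by rewrite (leq_trans (@logn_central_bin p m 0 pp _)) // m2 expn1.
have fact_ub n : n`! <= n ^ n.
  elim: n => // n IH; rewrite factS expnS leq_mul //.
  by apply: leq_trans IH _; case: n => // n; rewrite leq_exp2r.
have /dvdn_leq := dv; rewrite muln_gt0 expn_gt0 fact_gt0 c0 => /(_ isT) le.
have := leq_trans (central_bin_lb m) le; rewrite leqNgt => /negP; apply.
(* One factor exceeds [c]; the other bounds the factorial part. *)
have -> : 2 ^ m = 2 ^ 4 ^ r * 2 ^ 4 ^ r by rewrite /m mul2n -addnn expnD.
rewrite mulnC; apply: leq_ltn_trans (_ : c * 2 ^ 4 ^ r < _); last first.
  by rewrite ltn_pmul2r ?expn_gt0.
rewrite leq_mul2l; apply/orP; right.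
(* The source of the bound 9 on [r]: there the inequality reads 400 <= 512, while it fails at 8. *)
have le4 : 4 * (r.+1 * r.+1) <= 2 ^ r.
  elim: r r9 {clt none pc m m2 sq dv le} => // r IH.
  rewrite leq_eqVlt => /orP[/eqP<-//|]; rewrite ltnS => r9.
  by have := IH r9; rewrite expnS; nia.
apply: (@leq_trans (((2 ^ r.+1) ^ 2 ^ r.+1) ^ (2 * r.+1))).
  by rewrite leq_exp2r // muln_gt0.
rewrite -!expnM leq_exp2l // (_ : 4 = 2 ^ 2) // -expnM (mulnC 2 r) muln2 -addnn expnD expnS.
by move: (2 ^ r) le4 => X le4; nia.
Qed.

End SmallNonDivisor.

(** * Unitriangular representations *)

Section Unitriangular.
Local Open Scope ring_scope.
Variables (p k : nat) (v : seq bool).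
Hypothesis size_v : size v = k.
Implicit Types (f g : series) (x y : Free2).

Definition subword_mx f : 'M['F_p]_k.+1 :=
  \matrix_(i, j) if (i <= j)%N then (f (drop i (take j v)))%:~R else 0.

(** The summation index of the matrix product is the position at which the subword from [i] to [j]
    is split; indices outside that range contribute 0. *)
Lemma subword_mx_conv f g : subword_mx (conv f g) = subword_mx f *m subword_mx g.
Proof.
apply/matrixP => i j; rewrite !mxE.
under eq_bigr do rewrite !mxE.
have [ij|ji] := leqP i j; last first.
  rewrite big1 // => h _; case: leqP => ih; rewrite ?mul0r //.
  by rewrite leqNgt (leq_trans ji ih) mulr0.
have jk : (j <= size v)%N by rewrite size_v -ltnS.
rewrite convE rmorph_sum /= size_drop size_takel //.
pose F h : 'F_p := (if (i <= h)%N then (f (drop i (take h v)))%:~R else 0) *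
         (if (h <= j)%N then (g (drop h (take j v)))%:~R else 0).
rewrite -[RHS](big_mkord xpredT F) (@big_cat_nat _ _ _ i) //=; last exact: ltnW.
rewrite [X in _ = X + _]big_nat_cond [X in _ = X + _]big1 ?add0r; last first.
  by move=> h; rewrite andbT => /andP[_ hi]; rewrite /F leqNgt hi mul0r.
rewrite (@big_cat_nat _ _ _ j.+1) //=; last exact: leqW.
rewrite [X in _ = _ + X]big_nat_cond [X in _ = _ + X]big1 ?addr0; last first.
  by move=> h; rewrite andbT => /andP[jh _]; rewrite /F [(h <= j)%N]leqNgt jh mulr0.
rewrite -[X in _ = \sum_(X <= _ < _) _]add0n big_addn subSn // big_mkord.
apply: eq_bigr => h _; have hj : (h + i <= j)%N by have := ltn_ord h; lia.
rewrite /F leq_addl hj -intrM take_drop drop_drop take_takel //.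
Qed.

Lemma subword_mx1 : subword_mx series1 = 1%:M.
Proof.
apply/matrixP => i j; rewrite !mxE.
have le_size (h : 'I_k.+1) : (h <= size v)%N by rewrite size_v -ltnS.
case: ltngtP => [ij|ij|/val_inj <-] //=.
- rewrite /series1 -size_eq0 size_drop size_takel // subn_eq0 leqNgt ij.
  by rewrite -val_eqE /= ltn_eqF.
- by rewrite -val_eqE /= gtn_eqF.
- by rewrite eqxx /series1 drop_oversize ?eqxx ?size_takel.
Qed.

Lemma subword_mx_unit x : subword_mx (magnus x) \is a GRing.unit.
Proof.
apply/unitrP; exists (subword_mx (magnus x^-1%g)).
by rewrite -!mulmxE -!subword_mx_conv -!magnusM mulVg mulgV magnus1 subword_mx1.
Qed.

Definition urep x : {'GL_k.+1['F_p]} := Sub (subword_mx (magnus x)) (subword_mx_unit x).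

Lemma urepE x : GLval (urep x) = subword_mx (magnus x).
Proof. exact: SubK. Qed.

Lemma urepM : {morph urep : x y / (x * y)%g}.
Proof.
move=> x y; apply: val_inj.
rewrite -[RHS]/(GLval (urep x) * GLval (urep y)) -[LHS]/(GLval (urep (x * y)%g)).
by rewrite !urepE magnusM subword_mx_conv mulmxE.
Qed.

Lemma urep_lcs x : lcs k.+1 x -> urep x = 1%g.
Proof.
move=> /lcs_in_deg xk; apply: val_inj.
rewrite -[LHS]/(GLval (urep x)) -[RHS]/(1%:M) urepE -subword_mx1.
apply/matrixP => i j; rewrite !mxE; case: leqP => // ij.
have jk : (j <= size v)%N by rewrite size_v -ltnS.
case e: (drop i (take j v)) => [|c w]; first by rewrite magnus_nil.
rewrite xk // -e size_drop size_takel // ltnS (leq_trans (leq_subr _ _)) //; last first.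
  by have := ltn_ord j; rewrite ltnS.
rewrite andbT subn_gt0 ltn_neqAle ij andbT; apply/eqP => eij.
by have := congr1 size e; rewrite size_drop size_takel // eij subnn.
Qed.

Lemma urep_corner x : (0 < k)%N ->
  (magnus x v)%:~R != 0 :> 'F_p -> urep x != 1%g.
Proof.
move=> k0; apply: contraNneq => /(congr1 (fun u => GLval u ord0 ord_max)).
rewrite urepE GL_1E !mxE /= drop0 take_oversize ?size_v // => ->.
by rewrite (_ : (ord0 == ord_max) = false) ?eqxx // -val_eqE /= ltn_eqF.
Qed.

HB.instance Definition _ := isMultiplicative.Build Free2 {'GL_k.+1['F_p]} urep urepM.

End Unitriangular.

Section UnitriangularGroup.
Local Open Scope ring_scope.
Variables (F : finFieldType) (n : nat).

Definition unitri (A : 'M[F]_n.+1) :=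
  forall i j : 'I_n.+1, (j <= i)%N -> A i j = (i == j)%:R.

Lemma unitri_unipotent A : unitri A -> unipotent_mx A.
Proof.
move=> UA; exists n.+1; apply/matrixP => i j; rewrite [RHS]mxE.
(* Each factor [A - 1] moves the support one diagonal further up. *)
suff low m (a b : 'I_n.+1) : (b < a + m)%N -> ((A - 1) ^+ m) a b = 0.
  by apply: low; apply: leq_trans (ltn_ord j) (leq_addl _ _).
elim: m a b => [|m IH] a b.
  by rewrite addn0 expr0 mxE => ba; rewrite -val_eqE /= gtn_eqF.
move=> ba; rewrite exprS mxE big1 // => c _.
have [ca|ac] := leqP c a; first by rewrite !mxE UA // subrr mul0r.
by rewrite IH ?mulr0 //; apply: leq_trans ba _; rewrite addnS -addSn leq_add2r.
Qed.

Lemma card_above_diag : #|[pred q : 'I_n.+1 * 'I_n.+1 | (q.1 < q.2)%N]| = (n * n.+1 %/ 2)%N.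
Proof.
rewrite -sum1_card (eq_bigl (fun q : 'I_n.+1 * 'I_n.+1 => true && (q.1 < q.2)%N)) //.
rewrite -(pair_big_dep xpredT (fun i j : 'I_n.+1 => (i < j)%N) (fun _ _ => 1%N)) /=.
rewrite (exchange_big_dep xpredT) //=.
rewrite (eq_bigr (fun j : 'I_n.+1 => nat_of_ord j)) => [|j _]; last first.
  rewrite sum1_card -[RHS](card_ord j).
  have le : (j <= n.+1)%N by apply: ltnW.
  have inj : injective (widen_ord le) by move=> a b /(congr1 val)/= /val_inj.
  rewrite -(fintype.card_image inj 'I_j).
  apply: eq_card => i; apply/idP/idP => [ij|/fintype.imageP[a _ ->]]; last first.
    by rewrite unfold_in /=; apply: ltn_ord.
  by apply/fintype.imageP; exists (Ordinal ij) => //; apply: val_inj.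
by rewrite -(big_mkord xpredT id) bin2_sum bin2 mulnC divn2.
Qed.

Lemma card_unitri (Q : {set {'GL_n.+1[F]}}) :
  (forall x, x \in Q -> unitri (GLval x)) -> (#|Q| <= #|F| ^ (n * n.+1 %/ 2))%N.
Proof.
move=> UQ; rewrite -card_above_diag.
pose I := {q : 'I_n.+1 * 'I_n.+1 | (q.1 < q.2)%N}.
rewrite -(card_sig (fun q : 'I_n.+1 * 'I_n.+1 => (q.1 < q.2)%N)) -[leqRHS](card_ffun I F).
pose h (x : {'GL_n.+1[F]}) := [ffun q : I => GLval x (val q).1 (val q).2].
apply: (leq_card_in h) => x y xQ yQ hxy; apply/val_inj/matrixP => i j.
have [ij|ji] := ltnP i j; last first.
  by rewrite -[LHS]/(GLval x i j) -[RHS]/(GLval y i j) !UQ.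
have := congr1 (fun f : {ffun I -> F} => f (Sub (i, j) ij)) hxy.
by rewrite !ffunE.
Qed.

End UnitriangularGroup.

(** * Finite images *)

Section FiniteImage.
Local Open Scope group_scope.
Variables (G : groupType) (gT : finGroupType) (phi : {multiplicative G -> gT}).
Implicit Types (x y : G) (a b : gT).

Let phi1 : phi 1 = 1.
Proof. by apply: (mulgI (phi 1)); rewrite -gmulfM !mulg1. Qed.

Let phiV x : phi x^-1 = (phi x)^-1.
Proof. by apply: (mulgI (phi x)); rewrite -gmulfM !mulgV phi1. Qed.

Let phiJ x y : phi (x ^ y) = phi x ^ phi y.
Proof. by rewrite !conjgE !gmulfM phiV. Qed.

Let phiR x y : phi [~ x, y] = [~ phi x, phi y].
Proof. by rewrite !commgEl gmulfM phiV phiJ. Qed.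

Definition image_set : {set gT} := finset (fun a => `[< exists x, phi x = a >]).

Lemma image_setP a : reflect (exists x, phi x = a) (a \in image_set).
Proof. by rewrite inE; apply: asboolP. Qed.

Lemma mem_image_set x : phi x \in image_set.
Proof. by apply/image_setP; exists x. Qed.

Lemma image_group_set : group_set image_set.
Proof.
apply/group_setP; split=> [|a b /image_setP[x <-] /image_setP[y <-]].
  by rewrite -phi1 mem_image_set.
by rewrite -gmulfM mem_image_set.
Qed.

Canonical image_group := Group image_group_set.

(** A homomorphism carries the lower central series onto that of its image. The two definitions take
    commutators in opposite orders, which [invgR] reconciles. *)
Lemma lcn_image n a :
  reflect (exists2 x, lcs n.+1 x & phi x = a) (a \in 'L_n.+1(image_group)).
Proof.
apply: (iffP idP) => [|[x Hx <-]].
  elim: n a => [|n IH] a; first by case/image_setP => x; exists x.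
  have gH : group_set (finset (fun b => `[< exists2 x, lcs n.+2 x & phi x = b >])).
    apply/group_setP; split=> [|b c].
      by rewrite inE; apply/asboolP; exists 1; first exact: lcs_one.
    rewrite !inE => -[x Hx <-] [y Hy <-].
    exists (x * y); first exact: lcs_mul.
    by rewrite gmulfM.
  suff /fintype.subsetP sub : 'L_n.+2(image_group) \subset Group gH.
    by move=> /sub; rewrite inE => /asboolP.
  rewrite lcnSn gen_subG; apply/fintype.subsetP => c /imset2P[b d /IH[x Hx <-]].
  move=> /image_setP[y <-] ->; rewrite inE; apply/asboolP; exists [~ x, y].
    by rewrite -invgR; apply/lcs_inv/lcs_commT.
  exact: phiR.
elim: n x Hx => [|n IH] x; first by rewrite lcn1 mem_image_set.
have sH : is_subgroup [set x | phi x \in 'L_n.+2(image_group)].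
  split=> [|y z Hy Hz|y Hy] /=; first by rewrite phi1 group1.
    by rewrite gmulfM groupM.
  by rewrite phiV groupV.
move: x; apply: subgroup_generated_min sH _ => _ [y _] [z /IH Hz <-] /=.
by rewrite phiR -invgR groupV; apply: (mem_commg Hz (mem_image_set y)).
Qed.

Lemma nil_class_image k w : (0 < k)%N ->
    (forall x, lcs k.+1 x -> phi x = 1) -> lcs k w -> phi w != 1 ->
  nilpotent image_group /\ nil_class image_group = k.
Proof.
move=> k0 phik wk w1.
have Lk : 'L_k.+1(image_group) = 1.
  apply/trivgP/fintype.subsetP => a /lcn_image[x /phik + <-] => ->; exact: set11.
have nil : nilpotent image_group by apply/lcnP; exists k.
split=> //; apply/eqP; rewrite eqn_leq; apply/andP; split; first exact/lcn_nil_classP.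
(* A smaller class would kill the term of the series that contains [phi w]. *)
case: k k0 wk {phik Lk} => // k _ wk; rewrite ltnNge; apply/negP => /(lcn_nil_classP k nil) Lk.
have : phi w \in 'L_k.+1(image_group) by apply/lcn_image; exists w.
by rewrite Lk => /set1P e; rewrite e eqxx in w1.
Qed.

Lemma hom_kernel_normal : is_normal_subgroup (hom_kernel phi).
Proof.
rewrite /hom_kernel; split=> [|x y /= Hx]; last by rewrite phiJ Hx conj1g.
split=> [|x y /= Hx Hy|x /= Hx] //=; first by rewrite gmulfM Hx Hy mulg1.
by rewrite phiV Hx invg1.
Qed.

Lemma hom_kernel_index : has_index (hom_kernel phi) #|image_set|.
Proof.
(* The left cosets of the kernel are the fibres over the image, which [el] enumerates; the default 1
   is never reached below its size. *)
pose fib a := [set x | phi x = a]; pose el (i : nat) := nth 1 (enum image_set) i.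
have el_in i : (i < #|image_set|)%N -> el i \in image_set.
  by move=> im; rewrite -mem_enum mem_nth // -cardE.
rewrite /has_index (_ : left_cosets _ = (fib \o el) @` `I_#|image_set|); last first.
  apply/seteqP; split=> [A [x ->]|_ [i /el_in/image_setP[x phix] <-]].
    exists (index (phi x) (enum image_set)).
      by rewrite /= cardE index_mem mem_enum mem_image_set.
    rewrite /= /el nth_index ?mem_enum ?mem_image_set //.
    apply/seteqP; split=> [y /= phiy|_ /= [h phih <-]].
      by exists (x^-1 * y); rewrite ?mulVKg // /hom_kernel /= gmulfM phiV phiy mulVg.
    by rewrite /fib /= gmulfM phih mulg1.
  exists x; apply/seteqP; split=> [y /= phiy|_ /= [h phih <-]].
    exists (x^-1 * y); rewrite ?mulVKg // /hom_kernel /= gmulfM phiV phix phiy.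
    by rewrite mulVg.
  by rewrite /fib /= gmulfM phih mulg1.
apply: inj_card_eq => i j; rewrite !inE /= => im jm e.
have /image_setP[x phix] := el_in _ im.
have : fib (el i) x by [].
rewrite e /fib /= phix => eij; apply/eqP.
by rewrite -(nth_uniq 1 _ _ (enum_uniq (mem image_set))) -?cardE //; apply/eqP.
Qed.

End FiniteImage.

(** * The separating quotient *)

Lemma intr_Fp_eq0 (p : nat) (z : int) : prime p ->
  ((z%:~R : 'F_p) == 0)%R = (p %| `|z|)%N.
Proof.
move=> pp; rewrite (dvdn_pcharf (pchar_Fp pp)).
by case: z => m //; rewrite NegzE rmorphN oppr_eq0.
Qed.

(** Take the least r >= 9 with c < 2^(4^r), so that p <= 4^(r+1). If r = 9, this is 4^10. Otherwise
    minimality gives 2^(4^(r-1)) <= c <= n^(2k), hence 4^(r-1) ln 2 <= 2k ln n, and 4^(r+1) = 16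
    4^(r-1) yields the term 32k. *)
Lemma exists_small_prime (R : realType) (k n c : nat) :
  (1 < n)%N -> (0 < c)%N -> (c <= n.+1 ^ k)%N ->
  exists p, [/\ prime p, ~~ (p %| c)%N &
    (p%:R <= (4 ^ 10 + 32 * k)%N%:R / ln 2 * ln n%:R :> R)%R].
Proof.
move=> n1 c0 cn.
pose P r := (9 <= r)%N && (c < 2 ^ 4 ^ r)%N.
have exP : exists r, P r.
  exists (c + 9)%N; rewrite /P leq_addl /=.
  apply: leq_trans (ltn_expl c (isT : 1 < 2)%N) _; rewrite leq_exp2l //.
  apply: leq_trans (ltnW (ltn_expl c (isT : 1 < 4)%N)) _.
  by rewrite leq_exp2l // leq_addr.
case: (ex_minnP exP) => r /andP[r9 clt] minr.
have [p [pp ple pc]] := exists_prime_nondivisor r9 c0 clt.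
exists p; split=> //.
have ln2 : (0 < ln 2 :> R)%R by rewrite ln_gt0 // ltr1n.
have lnn : (ln 2 <= ln n%:R :> R)%R.
  by rewrite ler_ln ?posrE ?ltr0n ?ler_nat // ltnW.
have key : (p%:R * ln 2 <= (4 ^ 10 + 32 * k)%N%:R * ln n%:R :> R)%R.
  have [r10|r10] := leqP r 9.
    apply: ler_pM; rewrite ?ler0n ?(ltW ln2) // ler_nat.
    apply: leq_trans ple _; apply: leq_trans (leq_addr _ _).
    by rewrite leq_exp2l.
  case: r r9 clt minr ple r10 => // r _ _ minr ple r10.
  have cge : (2 ^ 4 ^ r <= c)%N.
    rewrite leqNgt; apply/negP => lt.
    by have := minr r; rewrite /P lt andbT => /(_ r10); rewrite ltnn.
  have c2 : (2 ^ 4 ^ r <= n ^ (2 * k))%N.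
    apply: leq_trans cge (leq_trans cn _); rewrite expnM.
    by case: k {cn} => // k; rewrite leq_exp2r //; nia.
  have lnc : ((4 ^ r)%N%:R * ln 2 <= (2 * k)%N%:R * ln n%:R :> R)%R.
    have n0 : (0 < n%:R :> R)%R by rewrite ltr0n ltnW.
    rewrite !mulr_natl -!lnXn // -!natrX ler_ln ?posrE ?ltr0n ?expn_gt0 ?ler_nat //.
    by rewrite ltnW.
  have p16 : (p%:R <= 16 * (4 ^ r)%N%:R :> R)%R.
    by rewrite -natrM ler_nat; apply: leq_trans ple _; rewrite !expnS mulnA.
  have lnn0 : (0 <= ln n%:R :> R)%R by apply: le_trans lnn; apply: ltW.
  apply: (@le_trans _ _ (16 * ((4 ^ r)%N%:R * ln 2))%R).
    by rewrite mulrA; apply: ler_wpM2r => //; apply: ltW.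
  apply: (@le_trans _ _ (16 * ((2 * k)%N%:R * ln n%:R))%R).
    by apply: ler_wpM2l.
  rewrite mulrA -natrM; apply: ler_wpM2r => //; rewrite ler_nat.
  by rewrite mulnA; apply: leq_addl.
by rewrite mulrAC ler_pdivlMr.
Qed.

Unset Implicit Arguments.
Local Open Scope ring_scope.
Local Open Scope classical_set_scope.

Theorem theorem6p8 (R : realType) (k : nat) (hk : (1 <= k)%N) :
  exists C : R,
    forall w : Free2, (2 <= wlength w)%N -> at_level k w ->
    exists H : set Free2,
      [/\ is_normal_subgroup H,
          exists2 m : nat, has_index H m &
            m%:R <= C * ln (wlength w)%:R ^+ (k * k.+1 %/ 2)%N,
          ~ H w &
          exists p : nat, prime p /\
          exists (Q : {group {'GL_k.+1['F_p]}})
                 (phi : {multiplicative Free2 -> {'GL_k.+1['F_p]}}),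
            [/\ H = hom_kernel phi,
                range phi = [set x | x \in Q],
                nilpotent Q /\ nil_class Q = k &
                forall x, x \in Q -> unipotent_mx (GLval x)]].
Proof.
(* The base comes from [exists_small_prime], the exponent from the number of entries above the
   diagonal. *)
exists (((4 ^ 10 + 32 * k)%N%:R / ln 2) ^+ (k * k.+1 %/ 2)) => w w2 wk.
have [v sv cv] := magnus_detects hk wk.
have c0 : (0 < `|magnus w v|)%N by rewrite absz_gt0.
have cle : (`|magnus w v| <= (wlength w).+1 ^ k)%N.
  by have := magnus_bound w v; rewrite sv -lez_nat abszE -[Posz (_ ^ _)]natz natrX natz.
have [p [pp pc ple]] := exists_small_prime R w2 c0 cle.
pose phi : {multiplicative Free2 -> {'GL_k.+1['F_p]}} := @urep p k v sv.
have phiw : phi w != 1%g by apply: urep_corner => //; rewrite intr_Fp_eq0.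
have Quni x : x \in image_set phi -> unitri (GLval x).
  move=> /image_setP[y <-] i j ji; rewrite urepE mxE.
  have le_size (h : 'I_k.+1) : (h <= size v)%N by rewrite sv -ltnS.
  case: ltngtP ji => // [ji|/val_inj ->] _.
    by rewrite -val_eqE /= gtn_eqF.
  by rewrite eqxx drop_oversize ?magnus_nil ?size_takel.
exists (hom_kernel phi); split.
- exact: hom_kernel_normal.
- exists #|image_set phi|; first exact: hom_kernel_index.
  (* The index is the order of the image, which is at most that of the full unitriangular group. *)
  rewrite -exprMn; apply: (@le_trans _ _ (p%:R ^+ (k * k.+1 %/ 2))).
    rewrite -natrX ler_nat -[X in (_ <= X ^ _)%N](card_Fp pp).
    exact: card_unitri.
  by apply: lerXn2r; rewrite ?nnegrE ?ler0n // (le_trans _ ple).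
- by move=> e; rewrite e eqxx in phiw.
exists p; split=> //; exists (image_group phi), phi; split=> //.
- by apply/seteqP; split=> [a [x _ <-]|a /image_setP[x <-]]; [exact: mem_image_set | exists x].
- apply: (nil_class_image hk _ wk.1 phiw) => x; exact: urep_lcs.
- by move=> x /Quni /unitri_unipotent.
Qed.
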